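(* For all real numbers $[f],[g],[w]\in\mathcal{S}_{\mathbb{R}}$ we have $([f]*[g])*[w]=[f]*([g]*[w])$.
   Context: Conventions. $\omega=\{0,1,2,\dots\}$, $\omega_+=\omega\setminus\{0\}$, $[a,b]_\omega=\{n\in\omega:a\le n\le b\}$, $[a,\infty]_\omega=\{n\in\omega:n\ge a\}$; empty products equal $1$. A system function $\vartheta:\omega_+\to[2,\infty]_\omega$ is fixed. Contractions. For $f:\omega\to\omega$ and $n\in\omega_+$, the contraction $c_n$ is applicable to $f$ iff $f(n+1)\ge\vartheta(n)$, and then $c_n(f)(n)=f(n)+1$, $c_n(f)(n+1)=f(n+1)-\vartheta(n)$, $c_n(f)(k)=f(k)$ for other $k$. A sequence of contractions is a finite (possibly empty) composition of contractions; it is applicable to $f$ iff each contraction in turn is applicable to the result of the preceding ones. Sign. For $f:\omega\to\omega$, $\sigma(f)=0$ if $f(0)$ is odd and $\sigma(f)=1$ if $f(0)$ is even. Auxiliary functions. $h:\omega\to\omega$ is a primary auxiliary function ($h\in A_p$) if $h(k)<\vartheta(k-1)$ for all $k\ge2$ and for every $N\in\omega_+$ there is $M\ge N+1$ with $h(M)\ne\vartheta(M-1)-1$. It is a secondary auxiliary function ($h\in A_s$) if $h(k)<\vartheta(k-1)$ for all $k\ge2$ and there is $N\in\omega_+$ with $h(M)=\vartheta(M-1)-1$ for all $M\ge N+1$; the least such $N$ is $N^h_{\min}$. Base set. $W_1$ is the set of pairs $(h_p,h_s)\in A_p\times A_s$ such that, with $N=N^{h_s}_{\min}$, $h_p(k)=h_s(k)$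 for $k<N$, $h_p(N)=h_s(N)+1$, and $h_p(k)=0$ for $k>N$. Two pairs in $W_1$ are equivalent if their first components agree on $\omega_+$ and have the same sign; $F$ is the collection of sets obtained by taking, for each equivalence class, the set of all functions that are components of its pairs. $W_2$ is the set of primary auxiliary functions occurring in no pair of $W_1$; two elements of $W_2$ are equivalent if they agree on $\omega_+$ and have the same sign; $G_2$ is the set of equivalence classes. The base set is $B=F\cup G_2$. Real numbers. For $b\in B$, $r_b$ is the set of $f:\omega\to\omega$ for which there is $h\in b$ such that for every $N\in\omega_+$ some sequence of contractions $\mathcal{C}$ applicable to $f$ satisfies $\mathcal{C}(f)(n)=h(n)$ for all $n\in[0,N]_\omega$. Let $b_1,b_2\in B$ be the elements containing respectively the zero function, and the function with value $1$ at $0$ and $0$ elsewhere. $\mathcal{S}_{\mathbb{R}}$ (the set of real numbers) consists of all $r_b$ with $b\in B\setminus\{b_1,b_2\}$ together with $[0]:=r_{b_1}\cup r_{b_2}$. Distinct real numbers are disjoint. A function lying in some real number is called finite, and $[f]$ denotes the real number containing $f$. Multiplication. For $a,b\in\omega$ let $\Upsilon(a,b)=\max\{a,b\}-\min\{a,b\}$. For $n,k,K\in\omega_+$ let $$R(n,k,K)=\max\Big\{t\in\omega:\ t\prod_{j=1}^{n-1}\vartheta(j)\prod_{j=1}^{k-1}\vartheta(j)\le\prod_{j=1}^{K-1}\vartheta(j)\Big\}.$$ The rest function is $r(n,k,1)=R(n,k,1)$ and $r(n,k,M)=\Upsilon\big(R(n,k,M),\ \vartheta(M-1)R(n,k,M-1)\big)$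 for $M\ge2$. For finite $f,g$ the sub-product $f*g:\omega\to\omega$ is $(f*g)(0)=f(0)+g(0)$ and $(f*g)(M)=\sum_{n=1}^M\sum_{k=1}^M f(n)g(k)\,r(n,k,M)$ for $M\in\omega_+$. Multiplication of real numbers: $[f]*[g]:=[f*g]$ for any $f\in[f]$, $g\in[g]$ (independent of the choice of representatives). *)

(* Defs.v *)
(* MathComp, with the classical sets of MathComp-Analysis. *)
From mathcomp Require Import all_boot.
From mathcomp Require Import boolp classical_sets.
Set Implicit Arguments.
Unset Strict Implicit.
Unset Printing Implicit Defensive.

Local Open Scope classical_set_scope.
Local Open Scope nat_scope.

(* The system function, written theta, is used only at positive arguments. *)
Definition system_function (theta : nat -> nat) : Prop :=
  forall n, 0 < n -> 2 <= theta n.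

Definition applicable (theta : nat -> nat) (n : nat) (f : nat -> nat) : bool :=
  (0 < n) && (theta n <= f n.+1).

Definition contract (theta : nat -> nat) (n : nat) (f : nat -> nat) :
    nat -> nat :=
  fun k => if k == n then (f n).+1
           else if k == n.+1 then f n.+1 - theta n
           else f k.

(* A sequence of contractions is the list of its indices, first one applied
   first. *)
Fixpoint applicable_seq (theta : nat -> nat) (s : seq nat) (f : nat -> nat) :
    bool :=
  if s is n :: s' then
    applicable theta n f && applicable_seq theta s' (contract theta n f)
  else true.

Definition contract_seq (theta : nat -> nat) (s : seq nat) (f : nat -> nat) :
    nat -> nat :=
  foldl (fun g n => contract theta n g) f s.

Definition sign (f : nat -> nat) : nat := if odd (f 0) then 0 else 1.

Definition primary_aux (theta : nat -> nat) : set (nat -> nat) :=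
  [set h | (forall k, 2 <= k -> h k < theta (k - 1)) /\
           (forall N, 0 < N ->
              exists2 M, N + 1 <= M & h M <> theta (M - 1) - 1)].

Definition maximal_after (theta : nat -> nat) (h : nat -> nat) (N : nat) :
    Prop :=
  0 < N /\ forall M, N + 1 <= M -> h M = theta (M - 1) - 1.

Definition secondary_aux (theta : nat -> nat) : set (nat -> nat) :=
  [set h | (forall k, 2 <= k -> h k < theta (k - 1)) /\
           exists N, maximal_after theta h N].

Definition is_Nmin (theta : nat -> nat) (h : nat -> nat) (N : nat) : Prop :=
  maximal_after theta h N /\ forall N', maximal_after theta h N' -> N <= N'.

Definition W1 (theta : nat -> nat) : set ((nat -> nat) * (nat -> nat)) :=
  [set p | primary_aux theta p.1 /\ secondary_aux theta p.2 /\
     exists N, [/\ is_Nmin theta p.2 N,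
                   forall k, k < N -> p.1 k = p.2 k,
                   p.1 N = p.2 N + 1 &
                   forall k, N < k -> p.1 k = 0]].

Definition aux_equiv (h h' : nat -> nat) : Prop :=
  (forall k, 0 < k -> h k = h' k) /\ sign h = sign h'.

Definition baseF (theta : nat -> nat) : set (set (nat -> nat)) :=
  [set b | exists2 p, W1 theta p &
     b = [set h | exists2 q, W1 theta q /\ aux_equiv p.1 q.1 &
                             h = q.1 \/ h = q.2]].

Definition W2 (theta : nat -> nat) : set (nat -> nat) :=
  [set h | primary_aux theta h /\
           ~ exists2 p, W1 theta p & h = p.1 \/ h = p.2].

Definition baseG2 (theta : nat -> nat) : set (set (nat -> nat)) :=
  [set b | exists2 h, W2 theta h &
     b = [set h' | W2 theta h' /\ aux_equiv h h']].

Definition base (theta : nat -> nat) : set (set (nat -> nat)) :=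
  baseF theta `|` baseG2 theta.

Definition real_of_base (theta : nat -> nat) (b : set (nat -> nat)) :
    set (nat -> nat) :=
  [set f | exists2 h, b h &
     forall N, 0 < N ->
       exists2 s, applicable_seq theta s f &
                  forall n, n <= N -> contract_seq theta s f n = h n].

(* The element of the base set containing h; the default value set0 is
   irrelevant when h is an auxiliary function. *)
Definition base_containing (theta : nat -> nat) (h : nat -> nat) :
    set (nat -> nat) :=
  xget set0 [set b | base theta b /\ b h].

Definition base1 (theta : nat -> nat) : set (nat -> nat) :=
  base_containing theta (fun=> 0).

Definition base2 (theta : nat -> nat) : set (nat -> nat) :=
  base_containing theta (fun n => if n == 0 then 1 else 0).

Definition real_numbers (theta : nat -> nat) : set (set (nat -> nat)) :=
  [set real_of_base theta b | b in base theta `\` [set base1 theta; base2 theta]]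
  `|` [set real_of_base theta (base1 theta) `|` real_of_base theta (base2 theta)].

(* [f], the real number containing f; the default value set0 is taken exactly
   when f is not finite. *)
Definition real_of (theta : nat -> nat) (f : nat -> nat) : set (nat -> nat) :=
  xget set0 [set X | real_numbers theta X /\ X f].

Definition Upsilon (a b : nat) : nat := maxn a b - minn a b.

(* The product of theta j over 1 <= j <= n - 1. *)
Definition theta_prod (theta : nat -> nat) (n : nat) : nat :=
  \prod_(1 <= j < n) theta j.

(* The range of t loses nothing: the products are positive, so any t in the
   set of which the maximum is taken is at most theta_prod theta K. *)
Definition Rmax (theta : nat -> nat) (n k K : nat) : nat :=
  \max_(t < (theta_prod theta K).+1 |
        t * theta_prod theta n * theta_prod theta k <= theta_prod theta K) t.

Definition rest (theta : nat -> nat) (n k M : nat) : nat :=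
  if M <= 1 then Rmax theta n k M
  else Upsilon (Rmax theta n k M) (theta (M - 1) * Rmax theta n k (M - 1)).

Definition subprod (theta : nat -> nat) (f g : nat -> nat) : nat -> nat :=
  fun M => if M == 0 then f 0 + g 0
           else \sum_(1 <= n < M.+1) \sum_(1 <= k < M.+1)
                  f n * g k * rest theta n k M.

(* [f] * [g] = [f * g] for any representatives f and g: the union below runs
   over all representatives, and is a union of equal sets when X and Y are real
   numbers, since [f * g] does not depend on f in X and g in Y. *)
Definition real_mul (theta : nat -> nat) (X Y : set (nat -> nat)) :
    set (nat -> nat) :=
  \bigcup_(f in X) \bigcup_(g in Y) real_of theta (subprod theta f g).

(* Main.v *)
Require Import Defs.
From mathcomp Require Import all_boot all_order all_algebra archimedean.
From mathcomp Require Import boolp classical_sets reals Rstruct.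
From mathcomp Require Import ring lra zify.
Set Implicit Arguments.
Unset Strict Implicit.
Unset Printing Implicit Defensive.
Import Order.TTheory GRing.Theory Num.Theory.

(* Attach to f the value sum_(n >= 1) f n / P n, where P n is the product of the
   theta j with j < n.  A contraction preserves the value and f 0, and only
   moves mass towards smaller indices, so it never decreases a partial sum;
   hence f belongs to the real number of b exactly when f has the value and the
   parity at 0 of the elements of b.  Thus each real number is the class of all
   functions with given value x >= 0 and, unless x = 0, given parity at 0, and
   all such classes occur.  Since Rmax n k K is the quotient of P K by P n * P k,
   and rest is the sequence of its digits, the value of f * g is the product of
   the values, while the parities add.  Associativity is then that of the
   product of real numbers and of exclusive or. *)

(** * Contractions and digits *)

Section Digits.
Context (theta : nat -> nat) (htheta : system_function theta).
Local Notation P := (theta_prod theta).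

(* The numerator of the partial sum of [f n / P n] over [1 <= n <= K], written
   with denominator [P K]; the junk value [theta 0] only multiplies 0. *)
Fixpoint prefix_num (f : nat -> nat) (K : nat) : nat :=
  if K is k.+1 then theta k * prefix_num f k + f k.+1 else 0.

Definition reduced (h : nat -> nat) : Prop :=
  forall k, 2 <= k -> h k < theta (k - 1).

Lemma theta_gt0 n : 0 < n -> 0 < theta n.
Proof. by move=> /htheta; apply: leq_trans. Qed.

Lemma theta_prodS n : 0 < n -> P n.+1 = theta n * P n.
Proof. by move=> n0; rewrite /theta_prod big_nat_recr //= mulnC. Qed.

Lemma theta_prod01 n : n <= 1 -> P n = 1.
Proof. by move=> n1; rewrite /theta_prod big_geq. Qed.

Lemma theta_prod_gt0 n : 0 < P n.
Proof.
elim: n => [|[|n] IH]; [by rewrite theta_prod01.. |].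
by rewrite theta_prodS // muln_gt0 theta_gt0.
Qed.

Lemma theta_prod_ltS n : 0 < n -> P n < P n.+1.
Proof.
move=> n0; rewrite theta_prodS // -[X in X < _]mul1n ltn_pmul2r ?theta_prod_gt0 //.
exact: htheta.
Qed.

Lemma theta_prod_homo m n : m <= n -> P m <= P n.
Proof.
apply: (homo_leq (r := leq)) => //; first exact: leq_trans.
by case=> [|k]; [rewrite !theta_prod01 | apply/ltnW/theta_prod_ltS].
Qed.

Lemma theta_prod_lt m n : 0 < m -> m < n -> P m < P n.
Proof.
by move=> m0 mn; apply: leq_trans (theta_prod_ltS m0) (theta_prod_homo mn).
Qed.

Lemma leq_theta_prod n : n <= P n.
Proof.
elim: n => // [[|n] IH]; first by rewrite theta_prod01.
exact: leq_ltn_trans IH (theta_prod_ltS _).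
Qed.

Lemma eq_prefix_num f g K :
  (forall k, 0 < k <= K -> f k = g k) -> prefix_num f K = prefix_num g K.
Proof.
elim: K => //= K IH e; rewrite IH ?e //; first by rewrite ltnS leqnn.
by move=> k /andP[k0 kK]; rewrite e // k0 leqW.
Qed.

Lemma prefix_num_inj f g K : (forall k, k <= K -> prefix_num f k = prefix_num g k) ->
  forall k, 0 < k <= K -> f k = g k.
Proof.
move=> e [//|k] /andP[_ kK]; have := e _ kK; rewrite /= e ?(ltnW kK) //.
exact: addnI.
Qed.

(** A contraction trades [theta n] units at [n.+1] for one unit at [n], which the factor [theta n]
    of the recursion compensates from [n.+1] on. Only the prefix ending at [n] sees the gain without
    the loss. *)
Lemma prefix_num_contract n f K : K != n -> applicable theta n f ->
  prefix_num (contract theta n f) K = prefix_num f K.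
Proof.
move=> Kn /andP[n0 an].
have low k : k < n -> prefix_num (contract theta n f) k = prefix_num f k.
  move=> kn; apply: eq_prefix_num => j /andP[j0 jk].
  by rewrite /contract !ifN //; lia.
case: (ltnP K n) => [/low//|]; rewrite leq_eqVlt eq_sym (negbTE Kn) /=.
elim: K {Kn} => // K IH; rewrite ltnS leq_eqVlt => /predU1P[<-|nK] /=; last first.
  by rewrite IH // /contract !ifN //; lia.
rewrite {2}/contract eqxx ifN; last by lia.
case: n n0 an low {IH} => // n _ an low /=; rewrite low // {1}/contract eqxx.
by rewrite addnS mulnS; lia.
Qed.

Lemma prefix_num_contract_ge n f K : applicable theta n f ->
  prefix_num f K <= prefix_num (contract theta n f) K.
Proof.
move=> a; have [->|Kn] := eqVneq K n; last by rewrite prefix_num_contract.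
case: n a => // n a /=; rewrite (@eq_prefix_num (contract theta n.+1 f) f) => [|k kn].
  by rewrite {1}/contract eqxx leq_add2l.
by rewrite /contract !ifN //; lia.
Qed.

Lemma prefix_num_contract_seq_ge s f K : applicable_seq theta s f ->
  prefix_num f K <= prefix_num (contract_seq theta s f) K.
Proof.
elim: s f => //= n s IH f /andP[an as_].
exact: leq_trans (prefix_num_contract_ge _ an) (IH _ as_).
Qed.

Lemma prefix_num_contract_seq s f K : {in s, forall n, n < K} ->
  applicable_seq theta s f -> prefix_num (contract_seq theta s f) K = prefix_num f K.
Proof.
elim: s f => //= n s IH f sK /andP[an as_].
have nK : n < K by apply: sK; rewrite mem_head.
rewrite IH ?prefix_num_contract //; first by lia.
by move=> m ms; apply: sK; rewrite inE ms orbT.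
Qed.

Lemma contract_seq0 s f : applicable_seq theta s f -> contract_seq theta s f 0 = f 0.
Proof.
elim: s f => //= n s IH f /andP[/andP[n0 _] as_].
by rewrite IH // /contract; case: n n0 {as_}.
Qed.

Lemma applicable_seq_cat s t f : applicable_seq theta (s ++ t) f =
  applicable_seq theta s f && applicable_seq theta t (contract_seq theta s f).
Proof. by elim: s f => //= n s IH f; rewrite IH andbA. Qed.

Lemma contract_seq_cat s t f :
  contract_seq theta (s ++ t) f = contract_seq theta t (contract_seq theta s f).
Proof. exact: foldl_cat. Qed.

Lemma contract_seq_above s f K : {in s, forall n, n < K} ->
  forall k, K < k -> contract_seq theta s f k = f k.
Proof.
move=> sK k Kk; elim: s f sK => //= n s IH f sK.
have nK : n < K by apply: sK; rewrite mem_head.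
rewrite IH => [|m ms]; first by rewrite /contract !ifN //; lia.
by apply: sK; rewrite inE ms orbT.
Qed.

Lemma carry_position f K : 0 < K ->
  exists s, [/\ applicable_seq theta s f, {in s, forall n, n = K}
              & contract_seq theta s f K.+1 < theta K].
Proof.
move=> K0; have [q] := ubnP (f K.+1); elim: q f => // q IH f; rewrite ltnS => fq.
case: (ltnP (f K.+1) (theta K)) => [lt|ge]; first by exists [::].
have t0 := theta_gt0 K0.
have [|s [as_ sK lt]] := IH (contract theta K f).
  by rewrite /contract eqxx ifN; lia.
exists (K :: s); split=> //=; first by rewrite as_ /applicable K0 ge.
by move=> n; rewrite inE => /predU1P[//|]; apply: sK.
Qed.

(** Carries run from the top position downwards, so later contractions leave the positions already
    treated untouched. Keeping the indices below [K] preserves the prefix numerator at [K]. *)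
Lemma reduce_prefix f K : exists s, [/\ applicable_seq theta s f,
  {in s, forall n, n < K} &
  forall k, 2 <= k <= K -> contract_seq theta s f k < theta (k - 1)].
Proof.
elim: K f => [|[|K] IH] f; [by exists [::]; split=> // k; lia.. |].
have [s [as_ sK lt]] := carry_position f (ltn0Sn K).
have [t [at_ tK lt']] := IH (contract_seq theta s f).
exists (s ++ t); split; first by rewrite applicable_seq_cat as_.
  by move=> n; rewrite mem_cat => /orP[/sK->//|/tK]; apply: leqW.
move=> k /andP[k2]; rewrite contract_seq_cat leq_eqVlt => /predU1P[->|].
  by rewrite (contract_seq_above _ tK) // subn1.
by rewrite ltnS => kK; apply: lt'; rewrite k2.
Qed.

(** After division by [P k * P K]: numerator plus one over [P] does not increase, because a digit at
    most [theta K - 1] gives [theta K * a + h K.+1 + 1 <= theta K * (a + 1)]. *)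
Lemma prefix_num_reduced_gap h k K : 0 < k <= K ->
  (forall j, 2 <= j <= K -> h j < theta (j - 1)) ->
  (prefix_num h K).+1 * P k <= (prefix_num h k).+1 * P K.
Proof.
move=> /andP[k0]; elim: K => [|K IH]; first by lia.
rewrite leq_eqVlt => /predU1P[->//|]; rewrite ltnS => kK hK.
have K0 : 0 < K by apply: leq_trans kK.
rewrite theta_prodS // mulnCA; have {}IH := IH kK.
apply: (@leq_trans (theta K * ((prefix_num h K).+1 * P k))); last first.
  rewrite leq_pmul2l ?theta_gt0 //; apply: IH => j jK.
  by apply: hK; case/andP: jK => ->; lia.
rewrite mulnA leq_mul2r; apply/orP; right => /=.
by have := hK K.+1; rewrite subn1 /= ltnS K0 leqnn => /(_ isT); rewrite mulnS; lia.
Qed.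

(** * The rest function as a sequence of digits *)

Lemma Rmax_divn n k K : Rmax theta n k K = P K %/ (P n * P k).
Proof.
have pos : 0 < P n * P k by rewrite muln_gt0 !theta_prod_gt0.
rewrite /Rmax; apply/eqP; rewrite eqn_leq; apply/andP; split.
  by apply/bigmax_leqP => i; rewrite -mulnA leq_divRL.
have lt : P K %/ (P n * P k) < (P K).+1 by rewrite ltnS leq_div.
apply: (@leq_bigmax_cond _ _ (fun i : 'I_(P K).+1 => i : nat) (Ordinal lt)) => /=.
by rewrite -mulnA leq_divM.
Qed.

(** Positivity of [K] matters, as [P 0] and [P 1] are both 1. *)
Lemma Rmax_eq0 n k K : 0 < K -> (K < n) || (K < k) -> Rmax theta n k K = 0.
Proof.
move=> K0 H; rewrite Rmax_divn divn_small //.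
have p m : 0 < P m by apply: theta_prod_gt0.
case/orP: H => /(theta_prod_lt K0) lt; apply: leq_trans lt _.
  by rewrite leq_pmulr.
by rewrite leq_pmull.
Qed.

(** [Upsilon] is a genuine difference here, since [theta K] times a floor is at most the floor of
    the multiple. Thus [Rmax] gives the prefix numerators of the digit sequence [rest]. *)
Lemma restS n k K : 0 < K ->
  theta K * Rmax theta n k K + rest theta n k K.+1 = Rmax theta n k K.+1.
Proof.
move=> K0; rewrite /rest ltnNge K0 /= subn1 /= /Upsilon.
have le : theta K * Rmax theta n k K <= Rmax theta n k K.+1.
  rewrite !Rmax_divn theta_prodS // leq_divRL ?muln_gt0 ?theta_prod_gt0 //.
  by rewrite -mulnA leq_mul2l leq_divM orbT.
by rewrite (maxn_idPl le) (minn_idPr le) subnKC.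
Qed.

Lemma prefix_num_subprod f g K : prefix_num (subprod theta f g) K =
  \sum_(1 <= n < K.+1) \sum_(1 <= k < K.+1) f n * g k * Rmax theta n k K.
Proof.
elim: K => [|K IH]; first by rewrite big_geq.
have -> : prefix_num (subprod theta f g) K.+1 = theta K * prefix_num (subprod theta f g) K +
  \sum_(1 <= n < K.+2) \sum_(1 <= k < K.+2) f n * g k * rest theta n k K.+1 by [].
(* The first index is separate: [rest] at 1 is [Rmax] by definition, while [restS] and [Rmax_eq0]
   need a positive index. *)
case: K IH => [_|K IH]; first by rewrite muln0.
(* Terms with [n] or [k] equal to [K.+2] vanish, so both double sums can run over the same range. *)
have -> : prefix_num (subprod theta f g) K.+1 =
   \sum_(1 <= n < K.+3) \sum_(1 <= k < K.+3) f n * g k * Rmax theta n k K.+1.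
  rewrite IH [RHS]big_nat_recr //= [X in _ + X]big1 ?addn0.
    apply: eq_bigr => n _; rewrite [RHS]big_nat_recr //= Rmax_eq0 ?ltnSn ?orbT //.
    by rewrite muln0 addn0.
  by move=> k _; rewrite Rmax_eq0 ?ltnSn // muln0.
rewrite big_distrr -big_split; apply: eq_bigr => n _ /=.
rewrite big_distrr -big_split; apply: eq_bigr => k _ /=.
by rewrite mulnCA -mulnDr restS.
Qed.

End Digits.

(** * Values *)

Section Value.
Context (R : realType) (theta : nat -> nat) (htheta : system_function theta).
Local Notation P := (theta_prod theta).
Local Notation num := (prefix_num theta).
Local Open Scope ring_scope.

Definition psum (f : nat -> nat) (K : nat) : R := (num f K)%:R / (P K)%:R.

(* The value of the function that agrees with [f] up to [K > 0] and has maximal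
   digits afterwards. *)
Definition psum_succ (f : nat -> nat) (K : nat) : R := (num f K).+1%:R / (P K)%:R.

(** A relation rather than a function: [x] is the supremum of the partial sums, and unbounded sums
    have no value. *)
Definition has_value (f : nat -> nat) (x : R) : Prop :=
  (forall K, psum f K <= x) /\ forall y, y < x -> exists K, y < psum f K.

Lemma natP_gt0 K : 0 < (P K)%:R :> R.
Proof. by rewrite ltr0n theta_prod_gt0. Qed.

Lemma natP_neq0 K : (P K)%:R != 0 :> R.
Proof. by rewrite gt_eqF ?natP_gt0. Qed.

Lemma inv_theta_prod_small (e : R) : 0 < e ->
  exists2 K, (0 < K)%N & forall L, (K <= L)%N -> (P L)%:R^-1 < e.
Proof.
move=> e0; exists (Num.truncn e^-1).+1 => // L KL.
rewrite invf_plt ?posrE ?natP_gt0 //; apply: lt_le_trans (truncnS_gt _) _.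
by rewrite ler_nat (leq_trans KL) // leq_theta_prod.
Qed.

Lemma psumS f K : psum f K.+1 = psum f K + (f K.+1)%:R / (P K.+1)%:R.
Proof.
rewrite /psum /=; case: K => [|K]; first by rewrite muln0 /= mul0r add0r.
rewrite theta_prodS // natrD !natrM; field.
by rewrite natP_neq0 pnatr_eq0 -lt0n theta_gt0.
Qed.

Lemma psumE f K : psum f K = \sum_(1 <= n < K.+1) (f n)%:R / (P n)%:R.
Proof.
elim: K => [|K IH]; first by rewrite big_geq // /psum mul0r.
by rewrite psumS IH [RHS]big_nat_recr.
Qed.

Lemma psum_homo f K L : (K <= L)%N -> psum f K <= psum f L.
Proof.
elim: L => [|L IH]; first by rewrite leqn0 => /eqP->.
rewrite leq_eqVlt => /predU1P[->//|/IH/le_trans]; apply.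
by rewrite psumS lerDl divr_ge0.
Qed.

Lemma psum_ge0 f K : 0 <= psum f K.
Proof. by rewrite divr_ge0. Qed.

Lemma psum_succE f K : psum_succ f K = psum f K + (P K)%:R^-1.
Proof. by rewrite /psum_succ -addn1 natrD mulrDl mul1r. Qed.

Lemma psum_succ_homo h K L : reduced theta h -> (0 < K <= L)%N ->
  psum_succ h L <= psum_succ h K.
Proof.
move=> hr /andP[K0 KL]; rewrite ler_pdivrMr ?natP_gt0 // mulrAC ler_pdivlMr ?natP_gt0 //.
rewrite -!natrM ler_nat; apply: prefix_num_reduced_gap; rewrite ?K0 // => j /andP[j2 _].
exact: hr.
Qed.

Lemma has_value_uniq f x y : has_value f x -> has_value f y -> x = y.
Proof.
move=> [ux lx] [uy ly]; apply/eqP; rewrite eq_le; apply/andP; split; rewrite leNgt; apply/negP.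
  by move=> /lx[K]; rewrite ltNge uy.
by move=> /ly[K]; rewrite ltNge ux.
Qed.

Lemma has_value_ge0 f x : has_value f x -> 0 <= x.
Proof. by case=> u _; apply: le_trans (u 0%N); apply: psum_ge0. Qed.

Lemma eq_psum f g : (forall k, (0 < k)%N -> f k = g k) -> psum f =1 psum g.
Proof.
by move=> e K; rewrite /psum (@eq_prefix_num _ f g) // => k /andP[k0 _]; exact: e.
Qed.

Lemma has_value_cofinal f g x :
  (forall K, exists L, psum f K <= psum g L) ->
  (forall K, exists L, psum g K <= psum f L) -> has_value f x -> has_value g x.
Proof.
move=> fg gf [ux lx]; split=> [K|y /lx[K yK]].
  by have [L] := gf K => /le_trans; apply.
by have [L KL] := fg K; exists L; apply: lt_le_trans KL.
Qed.

Lemma eq_has_value f g x : (forall k, (0 < k)%N -> f k = g k) ->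
  has_value f x -> has_value g x.
Proof.
by move=> e; apply: has_value_cofinal => K; exists K; rewrite (eq_psum e).
Qed.

(** Lower ends increase and upper ends decrease, so every partial sum lies below every upper end. *)
Lemma has_value_bounds h x : reduced theta h -> has_value h x ->
  forall k, (0 < k)%N -> psum h k <= x <= psum_succ h k.
Proof.
move=> hr [ux lx] k k0; rewrite ux leNgt; apply/negP => /lx[K].
rewrite ltNge => /negP; apply.
apply: le_trans (psum_homo h (leq_maxr k K)) _.
have := psum_succ_homo hr (K := k) (L := maxn k K).
rewrite k0 leq_maxl => /(_ isT); apply: le_trans.
by rewrite psum_succE lerDl invr_ge0.
Qed.

(** The enclosing intervals have length [1 / P k], which tends to 0. *)
Lemma bounds_has_value h x :
  (forall k, (0 < k)%N -> psum h k <= x <= psum_succ h k) -> has_value h x.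
Proof.
move=> b; split=> [[|K]|y yx].
- by apply: le_trans (psum_homo h (leq0n 1)) _; case/andP: (b 1%N isT).
- by case/andP: (b K.+1 isT).
have [K K0 /(_ _ (leqnn K)) KP] :
    exists2 K, (0 < K)%N & forall L, (K <= L)%N -> (P L)%:R^-1 < x - y.
  by apply: inv_theta_prod_small; rewrite subr_gt0.
exists K; move: (b K K0); rewrite psum_succE; lra.
Qed.

Lemma bounded_has_value f B : (forall K, psum f K <= B) -> exists x, has_value f x.
Proof.
move=> fB; set E := [set psum f K | K in setT]%classic.
have hE : has_sup E.
  split; first by exists (psum f 0); exists 0%N.
  by exists B => _ [K _ <-].
exists (sup E); split=> [K|y yE].
  by apply: ub_le_sup; [case: hE | exists K].
have : 0 < sup E - y by rewrite subr_gt0.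
by move=> /sup_adherent/(_ hE)[_ [K _ <-]]; rewrite subKr; exists K.
Qed.

Lemma reduced_has_value h : reduced theta h -> exists x, has_value h x.
Proof.
move=> hr; apply: (@bounded_has_value _ (psum_succ h 1)) => -[|K].
  by apply: le_trans (psum_homo h (leq0n 1)) _; rewrite psum_succE lerDl invr_ge0.
by apply: le_trans (psum_succ_homo hr (_ : 0 < 1 <= K.+1)%N) => //;
  rewrite psum_succE lerDl invr_ge0.
Qed.

(** A non-maximal digit beyond [k] makes the upper end drop strictly. *)
Lemma primary_value_lt h x : primary_aux theta h -> has_value h x ->
  forall k, (0 < k)%N -> x < psum_succ h k.
Proof.
move=> [hr np] hx k k0; have [[|M]] := np k k0; first by rewrite addn1.
rewrite addn1 ltnS !subn1 /= => kM hM; have M0 : (0 < M)%N by apply: leq_trans kM.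
have hr' : (h M.+1 < (theta M).-1)%N.
  by have := hr M.+1; rewrite ltnS M0 subn1 /= => /(_ isT); lia.
have /andP[_ xM] := has_value_bounds hr hx (ltn0Sn M).
apply: le_lt_trans xM _; apply: lt_le_trans (psum_succ_homo hr (_ : 0 < k <= M)%N);
  last by rewrite k0.
rewrite /psum_succ ltr_pdivrMr ?natP_gt0 // theta_prodS // natrM mulrA.
rewrite mulrAC mulfVK ?natP_neq0 // -natrM ltr_nat /=.
by rewrite mulSn; move: hr'; lia.
Qed.

(** The maximal digits are at least 1 because [theta] is at least 2, so the partial sums never stop
    growing. *)
Lemma secondary_value_gt h x : secondary_aux theta h -> has_value h x ->
  forall k, psum h k < x.
Proof.
move=> [hr [N [N0 mx]]] [ux _] k; set M := maxn k N.
apply: le_lt_trans (psum_homo h (leq_maxl k N)) _; rewrite -/M.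
apply: lt_le_trans (ux M.+1); rewrite psumS ltrDl divr_gt0 ?natP_gt0 // ltr0n.
have NM : (N <= M)%N by apply: leq_maxr.
rewrite mx ?addn1 // !subn1 /=; have := htheta (leq_trans N0 NM); lia.
Qed.

(** * Uniqueness and existence of expansions *)

Lemma psum_le_num f K x : (psum f K <= x) = ((num f K)%:R <= x * (P K)%:R).
Proof. by rewrite ler_pdivrMr ?natP_gt0. Qed.

Lemma psum_lt_num f K x : (psum f K < x) = ((num f K)%:R < x * (P K)%:R).
Proof. by rewrite ltr_pdivrMr ?natP_gt0. Qed.

Lemma le_psum_succ_num f K x : (x <= psum_succ f K) = (x * (P K)%:R <= (num f K).+1%:R).
Proof. by rewrite ler_pdivlMr ?natP_gt0. Qed.

Lemma lt_psum_succ_num f K x : (x < psum_succ f K) = (x * (P K)%:R < (num f K).+1%:R).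
Proof. by rewrite ltr_pdivlMr ?natP_gt0. Qed.

(** Either condition makes the numerator the floor of [x * P K]. *)
Lemma half_open_below_num f g K x : psum f K <= x < psum_succ f K ->
  psum g K <= x < psum_succ g K -> num f K = num g K.
Proof.
rewrite !psum_le_num !lt_psum_succ_num => /andP[a b] /andP[c d]; apply/eqP.
by rewrite eqn_leq; apply/andP; split; rewrite -ltnS -(ltr_nat R);
  [apply: le_lt_trans d|apply: le_lt_trans b].
Qed.

Lemma half_open_above_num f g K x : psum f K < x <= psum_succ f K ->
  psum g K < x <= psum_succ g K -> num f K = num g K.
Proof.
rewrite !psum_lt_num !le_psum_succ_num => /andP[a b] /andP[c d]; apply/eqP.
by rewrite eqn_leq; apply/andP; split; rewrite -ltnS -(ltr_nat R);
  [apply: lt_le_trans d|apply: lt_le_trans b].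
Qed.

(** Digits are recovered from consecutive prefix numerators, which are floors determined by [x]
    alone. *)
Lemma primary_value_inj h h' x : primary_aux theta h -> primary_aux theta h' ->
  has_value h x -> has_value h' x -> forall k, (0 < k)%N -> h k = h' k.
Proof.
move=> p p' v v' k k0; apply: (@prefix_num_inj theta _ _ k); last by rewrite k0 leqnn.
move=> [//|j] _; apply: (@half_open_below_num _ _ _ x).
  by rewrite v.1 primary_value_lt.
by rewrite v'.1 primary_value_lt.
Qed.

Lemma secondary_value_inj h h' x : secondary_aux theta h -> secondary_aux theta h' ->
  has_value h x -> has_value h' x -> forall k, (0 < k)%N -> h k = h' k.
Proof.
move=> p p' v v' k k0; apply: (@prefix_num_inj theta _ _ k); last by rewrite k0 leqnn.
move=> [//|j] _; apply: (@half_open_above_num _ _ _ x).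
  rewrite secondary_value_gt //=.
  by case: p => hr _; case/andP: (has_value_bounds hr v (ltn0Sn j)).
rewrite secondary_value_gt //=.
by case: p' => hr _; case/andP: (has_value_bounds hr v' (ltn0Sn j)).
Qed.

Lemma reduced_primary_or_secondary h : reduced theta h ->
  primary_aux theta h \/ secondary_aux theta h.
Proof.
move=> hr; case: (pselect (exists N, maximal_after theta h N)) => [s|ns]; [by right|left].
split=> // N N0; apply: contrapT => nM; apply: ns; exists N; split=> // M NM.
by apply: contrapT => hM; apply: nM; exists M.
Qed.

(* Applied with [A k / P k] the truncation of a real number to a multiple of
   [1 / P k], from below or strictly from below. *)
Lemma reduced_of_truncations (A : nat -> nat) (c : nat) :
  (forall k, (0 < k)%N -> (theta k * A k <= A k.+1 < theta k * (A k).+1)%N) ->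
  exists h, [/\ reduced theta h, h 0%N = c & forall k, (0 < k)%N -> num h k = A k].
Proof.
(* Digits are successive differences of truncations; the entry at 1 is the integer part, which
   [reduced] leaves free. *)
move=> HA; exists (fun k => if k is j.+1 then
  if j is 0%N then A 1%N else (A k - theta j * A j)%N else c).
split=> //.
  move=> [//|[//|k]] _; rewrite subn1 /=; have /andP[] := HA k.+1 isT.
  by rewrite mulnS; lia.
elim=> // -[_ _|k IH _]; first by rewrite /= muln0 add0n.
have -> (g : nat -> nat) : num g k.+2 = (theta k.+1 * num g k.+1 + g k.+2)%N by [].
by rewrite IH // subnKC //; case/andP: (HA k.+1 isT).
Qed.

(** The greedy expansion, with floors of [x * P k] as numerators; [c] will carry the sign. *)
Lemma exists_expansion_below (x : R) c : 0 <= x -> exists h,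
  [/\ reduced theta h, h 0%N = c & forall k, (0 < k)%N -> psum h k <= x < psum_succ h k].
Proof.
move=> x0; pose A k := Num.truncn (x * (P k)%:R).
have AP k : (A k)%:R <= x * (P k)%:R < (A k).+1%:R.
  by apply: truncn_itv; rewrite mulr_ge0.
have [|h [hr h0 hA]] := @reduced_of_truncations A c.
  move=> k k0; have /andP[a1 a2] := AP k; have /andP[b1 b2] := AP k.+1.
  rewrite -ltnS -2!(ltr_nat R) !natrM.
  have e : x * (P k.+1)%:R = (theta k)%:R * (x * (P k)%:R).
    by rewrite theta_prodS // natrM mulrCA.
  have t0 : 0 < (theta k)%:R :> R by rewrite ltr0n theta_gt0.
  apply/andP; split; first by apply: le_lt_trans b2; rewrite e ler_pM2l.
  by apply: le_lt_trans b1 _; rewrite e ltr_pM2l.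
exists h; split=> // k k0.
by rewrite psum_le_num lt_psum_succ_num hA.
Qed.

(** The numerators are now the largest integers strictly below [x * P k], natural numbers because
    [x] is positive. *)
Lemma exists_expansion_above (x : R) c : 0 < x -> exists h,
  [/\ reduced theta h, h 0%N = c & forall k, (0 < k)%N -> psum h k < x <= psum_succ h k].
Proof.
move=> x0.
have /choice[A AP] k : exists n : nat, n%:R < x * (P k)%:R <= n.+1%:R.
  have y0 : 0 < x * (P k)%:R by rewrite mulr_gt0 ?natP_gt0.
  have /andP[] := truncn_itv (ltW y0); set n := Num.truncn _.
  rewrite le_eqVlt => /predU1P[e _|lt lt']; last by exists n; rewrite lt ltW.
  (* Here [x * P k] is itself a positive integer, and its predecessor is taken. *)
  move: y0; rewrite -e ltr0n; case: n {e} => // n _; exists n.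
  by rewrite lexx ltr_nat ltnSn.
have [|h [hr h0 hA]] := @reduced_of_truncations A c.
  move=> k k0; have /andP[a1 a2] := AP k; have /andP[b1 b2] := AP k.+1.
  rewrite -ltnS -2!(ltr_nat R) !natrM.
  have e : x * (P k.+1)%:R = (theta k)%:R * (x * (P k)%:R).
    by rewrite theta_prodS // natrM mulrCA.
  have t0 : 0 < (theta k)%:R :> R by rewrite ltr0n theta_gt0.
  apply/andP; split; first by apply: lt_le_trans b2; rewrite e ltr_pM2l.
  by apply: lt_le_trans b1 _; rewrite e ler_pM2l.
exists h; split=> // k k0.
by rewrite psum_lt_num le_psum_succ_num hA.
Qed.

(** Termwise, the floor of [P K / (P n * P k)] is at most the quotient. *)
Lemma psum_subprod_le f g K : psum (subprod theta f g) K <= psum f K * psum g K.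
Proof.
rewrite (psumE f) (psumE g) /psum prefix_num_subprod // natr_sum mulr_suml mulr_suml.
apply: ler_sum => n _; rewrite natr_sum mulr_suml mulr_sumr; apply: ler_sum => k _.
rewrite !natrM Rmax_divn // mulrACA -mulrA; apply: ler_wpM2l; first by rewrite mulr_ge0.
rewrite ler_pdivrMr ?natP_gt0 // -invfM mulrC ler_pdivlMr ?mulr_gt0 ?natP_gt0 //.
by rewrite -!natrM ler_nat leq_divM.
Qed.

(** Each floor loses less than 1, so a term loses at most [f n * g k / P K]. With [L] fixed the
    total loss vanishes as [K] grows; terms with an index beyond [L] are dropped. *)
Lemma psum_subprod_ge f g L K : (L <= K)%N ->
  psum f L * psum g L -
    (\sum_(1 <= n < L.+1) \sum_(1 <= k < L.+1) f n * g k)%:R / (P K)%:R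
  <= psum (subprod theta f g) K.
Proof.
move=> LK; rewrite [X in _ <= X]/psum prefix_num_subprod //.
apply: (@le_trans _ _
  ((\sum_(1 <= n < L.+1) \sum_(1 <= k < L.+1)
    f n * g k * Rmax theta n k K)%:R / (P K)%:R)).
  rewrite !psumE lerBlDr -mulrDl -natrD -big_split natr_sum !mulr_suml /=.
  apply: ler_sum => n _; rewrite -big_split natr_sum mulr_suml mulr_sumr /=.
  apply: ler_sum => k _; rewrite -mulnSr !natrM mulrACA -[X in _ <= X]mulrA.
  apply: ler_wpM2l; first by rewrite mulr_ge0.
  rewrite ler_pdivlMr ?natP_gt0 // -invfM mulrC ler_pdivrMr ?mulr_gt0 ?natP_gt0 //.
  rewrite Rmax_divn // -!natrM ler_nat ltnW // ltn_ceil // muln_gt0.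
  by rewrite !theta_prod_gt0.
rewrite ler_pM2r ?invr_gt0 ?natP_gt0 // ler_nat.
rewrite [X in (_ <= X)%N](big_cat_nat (n := L.+1)) //=; apply: leq_trans (leq_addr _ _).
apply: leq_sum => n _; rewrite [X in (_ <= X)%N](big_cat_nat (n := L.+1)) //=.
exact: leq_addr.
Qed.

Lemma has_value_subprod f g x y : has_value f x -> has_value g y ->
  has_value (subprod theta f g) (x * y).
Proof.
move=> vf vg; split=> [K|z].
  apply: le_trans (psum_subprod_le _ _ _) _.
  by apply: ler_pM; rewrite ?psum_ge0 ?vf.1 ?vg.1.
have [z0|z0] := ltP z 0; first by exists 0%N; apply: lt_le_trans (psum_ge0 _ _).
move=> zxy; have xy0 := le_lt_trans z0 zxy.
have y0 : 0 < y.
  rewrite lt_neqAle (has_value_ge0 vg) andbT eq_sym; apply: contraTneq xy0 => ->.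
  by rewrite mulr0 ltxx.
have [K1 zK1] : exists K, z / y < psum f K by apply: vf.2; rewrite ltr_pdivrMr.
have f0 : 0 < psum f K1 by apply: le_lt_trans zK1; rewrite divr_ge0 // ltW.
have [K2 zK2] : exists K, z / psum f K1 < psum g K.
  by apply: vg.2; rewrite ltr_pdivrMr // mulrC -ltr_pdivrMr.
pose L := maxn K1 K2.
have zL : z < psum f L * psum g L.
  move: zK2; rewrite ltr_pdivrMr // mulrC => /lt_le_trans; apply.
  by apply: ler_pM; rewrite ?psum_ge0 ?psum_homo ?leq_maxl ?leq_maxr.
set C := (\sum_(1 <= n < L.+1) \sum_(1 <= k < L.+1) f n * g k)%N.
(* The loss is [C / P M]; dividing by [C.+1] instead of [C] covers the case where [C] is 0. *)
have [K _ KP] : exists2 K, (0 < K)%N & forall M, (K <= M)%N ->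
    (P M)%:R^-1 < (psum f L * psum g L - z) / C.+1%:R.
  by apply: inv_theta_prod_small; rewrite divr_gt0 ?ltr0Sn ?subr_gt0.
exists (maxn K L); apply: lt_le_trans (psum_subprod_ge f g (leq_maxr K L)).
have := KP _ (leq_maxl K L); rewrite -/C ltr_pdivlMr ?ltr0Sn // -addn1 natrD.
have : 0 < (P (maxn K L))%:R^-1 :> R by rewrite invr_gt0 natP_gt0.
lra.
Qed.

End Value.

(** * Real numbers as classes of functions *)

Section Classes.
Context (R : realType) (theta : nat -> nat) (htheta : system_function theta).
Local Notation P := (theta_prod theta).
Local Notation num := (prefix_num theta).
Local Notation psum := (psum R theta).
Local Notation psum_succ := (psum_succ R theta).
Local Notation has_value := (@has_value R theta).
Local Open Scope ring_scope.
Local Open Scope classical_set_scope.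

Lemma eq_signP f g : sign f = sign g <-> odd (f 0%N) = odd (g 0%N).
Proof. by rewrite /sign; case: (odd (f 0%N)); case: (odd (g 0%N)). Qed.

Lemma eq_reduced h h' : (forall k, (0 < k)%N -> h k = h' k) ->
  reduced theta h -> reduced theta h'.
Proof. by move=> e hr k k2; rewrite -e ?hr //; lia. Qed.

Lemma eq_primary h h' : (forall k, (0 < k)%N -> h k = h' k) ->
  primary_aux theta h -> primary_aux theta h'.
Proof.
move=> e [hr hM]; split=> [|N N0]; first exact: eq_reduced e hr.
by have [M NM M1] := hM N N0; exists M => //; rewrite -e //; lia.
Qed.

Lemma eq_maximal_after h h' N : (forall k, (0 < k)%N -> h k = h' k) ->
  maximal_after theta h N -> maximal_after theta h' N.
Proof. by move=> e [N0 mx]; split=> // M NM; rewrite -e ?mx //; lia. Qed.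

Lemma eq_secondary h h' : (forall k, (0 < k)%N -> h k = h' k) ->
  secondary_aux theta h -> secondary_aux theta h'.
Proof.
move=> e [hr [N mx]]; split; first exact: eq_reduced e hr.
by exists N; apply: eq_maximal_after e mx.
Qed.

(** Since [N] is positive, the entries at 0 only have to agree with each other; a pair in [W1] can
    thus be given any common head. *)
Lemma eq_W1 p q : (forall k, (0 < k)%N -> p.1 k = q.1 k) ->
  (forall k, (0 < k)%N -> p.2 k = q.2 k) -> q.1 0%N = q.2 0%N ->
  W1 theta p -> W1 theta q.
Proof.
move=> e1 e2 e0 [pp [ps [N [[mx mn] lt eqN gt]]]]; have N0 := mx.1.
split; first exact: eq_primary e1 pp.
split; first exact: eq_secondary e2 ps.
exists N; split.
- split=> [|N' mx']; first exact: eq_maximal_after e2 mx.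
  by apply: mn; apply: eq_maximal_after mx' => k k0; rewrite e2.
- by move=> [//|k] kN; rewrite -e1 // -e2 // lt.
- by rewrite -e1 // -e2.
- by move=> k Nk; rewrite -e1 ?gt //; lia.
Qed.

(** * Pairs of expansions with the same value *)

Lemma W1_head p : W1 theta p -> p.1 0%N = p.2 0%N.
Proof. by move=> [_ [_ [N [[[N0 _] _] lt _ _]]]]; apply: lt. Qed.

Lemma primary_not_secondary h : primary_aux theta h -> ~ secondary_aux theta h.
Proof. by move=> [_ np] [_ [N [N0 mx]]]; have [M /mx] := np N N0. Qed.

(** The partner rounds the maximal tail up: one is added at the least [N], and zeros follow.
    Minimality of [N] ensures that the digit there, if bounded at all, is not yet maximal. *)
Lemma W1_of_secondary h : secondary_aux theta h -> exists h1, W1 theta (h1, h).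
Proof.
move=> hs; have [hr [N0 mxN0]] := hs.
have exN : exists N, `[< maximal_after theta h N >] by exists N0; apply/asboolP.
case: (ex_minnP exN) => N /asboolP mx mn.
have {}mn N' : maximal_after theta h N' -> (N <= N')%N by move=> ?; apply/mn/asboolP.
have N_gt0 := mx.1.
exists (fun k => if (k < N)%N then h k else if k == N then (h N + 1)%N else 0%N).
split; last first.
  split=> //; exists N; split=> //=.
  - by move=> k ->.
  - by rewrite ltnn eqxx.
  - by move=> k Nk; rewrite ltnNge (ltnW Nk) /= gtn_eqF.
split=> [k k2 /=|M0 _].
  have t0 : (0 < theta (k - 1))%N by apply: theta_gt0 => //; lia.
  case: (ltnP k N) => _; first exact: hr.
  case: eqP => // kN; have := hr _ k2; rewrite leq_eqVlt addn1 -kN => /orP[/eqP hk|//].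
  have /mn : maximal_after theta h (k - 1).
    split=> [|M]; first by lia.
    rewrite subnK; last by lia.
    rewrite leq_eqVlt => /predU1P[<-|kM]; first by lia.
    by apply: mx.2; lia.
  by lia.
exists (maxn N M0).+1 => /=; first by rewrite addn1 ltnS leq_maxr.
rewrite ltnNge (leqW (leq_maxl _ _)) /= gtn_eqF ?ltnS ?leq_maxl // !subn1 /=.
by have := htheta (leq_trans N_gt0 (leq_maxl N M0)); lia.
Qed.

(** This is 1.000... against 0.999...: the sums of [p.1] become constant and equal to the upper ends
    of [p.2]. *)
Lemma W1_psum p : W1 theta p -> exists2 N, (0 < N)%N &
  forall K, (N <= K)%N -> psum p.1 K = psum_succ p.2 K /\ psum p.1 K = psum p.1 N.
Proof.
move=> [_ [_ [N [[[N0 mx] _] lt eqN gt]]]]; exists N => // K NK; split.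
  congr (_%:R / _); elim: K NK => [|K IH]; first by rewrite leqNgt N0.
  rewrite leq_eqVlt => /predU1P[NK|NK].
    rewrite /= -NK eqN addnA addn1; congr ((_ * _ + _).+1)%N.
    by apply: eq_prefix_num => k kK; apply: lt; rewrite NK ltnS; case/andP: kK.
  have t0 : (0 < theta K)%N by apply: (theta_gt0 htheta); exact: leq_trans N0 NK.
  by rewrite /= gt // mx ?addn1 // !subn1 /= IH // mulnS; lia.
elim: K NK => [|K IH]; first by rewrite leqNgt N0.
rewrite leq_eqVlt => /predU1P[<-//|NK].
by rewrite psumS // gt // mul0r addr0 IH.
Qed.

Lemma W1_value p x : W1 theta p -> has_value p.1 x <-> has_value p.2 x.
Proof.
move=> w.
have impl y : has_value p.1 y -> has_value p.2 y.
  move=> v; have [N N0 HN] := W1_psum w.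
  have yN : y = psum p.1 N.
    apply/eqP; rewrite eq_le v.1 andbT leNgt; apply/negP => /v.2[K].
    apply/negP; rewrite -leNgt; apply: le_trans (psum_homo _ htheta _ (leq_maxr N K)) _.
    by rewrite (HN _ (leq_maxl _ _)).2.
  have [_ [[hr _] _]] := w.
  apply: bounds_has_value => // k k0.
  have [e1 e2] := HN _ (leq_maxl N k).
  apply/andP; split.
    apply: le_trans (psum_homo _ htheta _ (leq_maxr N k)) _.
    by rewrite yN -e2 e1 psum_succE lerDl invr_ge0.
  rewrite yN -e2 e1; apply: psum_succ_homo => //.
  by rewrite k0 leq_maxr.
split=> [|v2]; first exact: impl.
(* Conversely, [p.1] has some value because it is reduced; the direction just shown passes it to
   [p.2], where values are unique. *)
have [[hr _] _] := w.
have [y v1] := reduced_has_value R htheta hr.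
by rewrite (has_value_uniq v2 (impl _ v1)).
Qed.

(** * Base elements described by value and parity *)

Definition value_base (x : R) (s : bool) : set (nat -> nat) :=
  [set h | [/\ reduced theta h, has_value h x & odd (h 0%N) = s]].

Definition value_class (x : R) (s : bool) : set (nat -> nat) :=
  [set f | has_value f x /\ (x = 0 \/ odd (f 0%N) = s)].

Definition set_head (h : nat -> nat) (c : nat) : nat -> nat :=
  fun k => if k is 0%N then c else h k.

Lemma set_head_pos h c k : (0 < k)%N -> h k = set_head h c k.
Proof. by case: k. Qed.

(** A reduced function with value [x] agrees off 0 with [p.1] if primary and with [p.2] if
    secondary; changing the head of the other component completes it to a pair in [W1]. *)
Lemma W1_class p x : W1 theta p -> has_value p.1 x ->
  [set h | exists2 q, W1 theta q /\ aux_equiv p.1 q.1 & h = q.1 \/ h = q.2]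
  = value_base x (odd (p.1 0%N)).
Proof.
move=> w v1; have v2 := (W1_value x w).1 v1; apply/seteqP; split=> h /=.
  move=> [q [wq [epq /eq_signP opq]] hq]; have u1 := eq_has_value epq v1.
  case: hq => ->.
    by split=> //; case: wq => [[]].
  split; first by case: wq => _ [[]].
    exact: (W1_value x wq).1.
  by rewrite -(W1_head wq).
move=> [hr v o]; case: (reduced_primary_or_secondary hr) => [hp|hs].
  have e := primary_value_inj htheta w.1 hp v1 v.
  exists (h, set_head p.2 (h 0%N)); last by left.
  split; last by split=> //; apply/eq_signP.
  by apply: eq_W1 w => //; apply: set_head_pos.
have e := secondary_value_inj htheta w.2.1 hs v2 v.
exists (set_head p.1 (h 0%N), h); last by right.
split; last by split; [apply: set_head_pos | apply/eq_signP].
by apply: eq_W1 w => //; apply: set_head_pos.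
Qed.

(** A secondary function of the same value would have a primary partner agreeing with [h] off 0,
    which would put [h] in a pair of [W1]. *)
Lemma W2_class h x : W2 theta h -> has_value h x ->
  [set h' | W2 theta h' /\ aux_equiv h h'] = value_base x (odd (h 0%N)).
Proof.
move=> [hp nw] v; apply/seteqP; split=> g /=.
  move=> [[[gr _] _] [e /eq_signP o]]; split=> //; exact: eq_has_value e v.
move=> [gr vg o]; case: (reduced_primary_or_secondary gr) => [gp|gs].
  have e := primary_value_inj htheta hp gp v vg.
  split; last by split=> //; apply/eq_signP.
  split=> // -[q wq []] gq; last first.
    by apply: (primary_not_secondary gp); rewrite gq; apply: wq.2.1.
  apply: nw; exists (h, set_head q.2 (h 0%N)); last by left.
  apply: eq_W1 wq => //=; last exact: set_head_pos.
  by move=> k k0; rewrite -gq e.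
have [g1 w] := W1_of_secondary gs.
have v1 := (W1_value x w).2 vg.
exfalso; apply: nw; exists (h, set_head g (h 0%N)); last by left.
apply: (eq_W1 _ _ _ w) => //=; last exact: set_head_pos.
exact: primary_value_inj w.1 hp v1 v.
Qed.

Lemma base_value_base b : base theta b ->
  exists x s, 0 <= x /\ b = value_base x s.
Proof.
case=> [[p w ->]|[h w ->]].
  have [[hr _] _] := w; have [x v] := reduced_has_value R htheta hr.
  by exists x, (odd (p.1 0%N)); split; [exact: has_value_ge0 v | exact: W1_class].
have [[hr _] _] := w; have [x v] := reduced_has_value R htheta hr.
by exists x, (odd (h 0%N)); split; [exact: has_value_ge0 v | exact: W2_class].
Qed.

Lemma base_of_reduced h x : reduced theta h -> has_value h x ->
  base theta (value_base x (odd (h 0%N))).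
Proof.
move=> hr v; case: (reduced_primary_or_secondary hr) => [hp|hs]; last first.
  have [h1 w] := W1_of_secondary hs.
  left; exists (h1, h) => //; rewrite (W1_class w ((W1_value x w).2 v)).
  by rewrite (W1_head w).
case: (pselect (exists2 p, W1 theta p & h = p.1 \/ h = p.2)) => [[p w hw]|nw].
  have o : odd (p.1 0%N) = odd (h 0%N) by case: hw => ->; rewrite ?(W1_head w).
  left; exists p => //; rewrite -o -(W1_class w) //.
  by case: hw => e; move: v; rewrite e //; apply: (W1_value x w).2.
by right; exists h => //; rewrite (W2_class _ v).
Qed.

Lemma value_base_nonempty x s : 0 <= x -> exists h, value_base x s h.
Proof.
move=> x0; have [h [hr h0 b]] := exists_expansion_below htheta (s : nat) x0.
exists h; split=> //; last by rewrite h0; case: (s).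
by apply: bounds_has_value => // k /b/andP[-> /ltW].
Qed.

Lemma base_value_baseT x s : 0 <= x -> base theta (value_base x s).
Proof.
by move=> /(value_base_nonempty s)[h [hr v <-]]; apply: base_of_reduced.
Qed.

Lemma base_containingE h x : reduced theta h -> has_value h x ->
  base_containing theta h = value_base x (odd (h 0%N)).
Proof.
move=> hr v; apply: xget_unique; first by split=> //; apply: base_of_reduced.
move=> b [/base_value_base[y [s [_ ->]]] [_ vy <-]].
by rewrite (has_value_uniq vy v).
Qed.

Lemma eq0_reduced_value h : (forall k, (0 < k)%N -> h k = 0%N) ->
  reduced theta h /\ has_value h 0.
Proof.
move=> h0; split=> [k k2|]; first by rewrite h0; [apply: (theta_gt0 htheta)|]; lia.
have s0 K : psum h K = 0.
  elim: K => [|K IH]; first exact: mul0r.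
  by rewrite psumS // IH h0 // mul0r addr0.
by split=> [K|y y0]; [rewrite s0 | exists 0%N; rewrite s0].
Qed.

Lemma base1E : base1 theta = value_base 0 false.
Proof.
have [hr v] := @eq0_reduced_value (fun=> 0%N) (fun _ _ => erefl).
exact: base_containingE.
Qed.

Lemma base2E : base2 theta = value_base 0 true.
Proof.
have [|hr v] := @eq0_reduced_value (fun n => if n == 0 then 1 else 0)%N; first by case.
exact: base_containingE.
Qed.

(** Reducing [f] up to [M] keeps its sum at [M]. The prefix numerators up to [N] of the result are
    then the floors of [psum f M * P k], and so are those of [h]. *)
Lemma contract_to_expansion f h N M : (N <= M)%N -> f 0%N = h 0%N ->
  (forall k, (0 < k <= N)%N -> psum h k <= psum f M < psum_succ h k) ->
  exists2 s, applicable_seq theta s f &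
    forall n, (n <= N)%N -> contract_seq theta s f n = h n.
Proof.
move=> NM fh0 bh; have [s [as_ sM lt]] := reduce_prefix htheta f M.
exists s => // -[_|n nN]; first by rewrite (contract_seq0 as_).
set g := contract_seq theta s f in lt *.
have gM : psum g M = psum f M by rewrite /psum prefix_num_contract_seq.
apply: (@prefix_num_inj theta _ _ N) => // -[//|k] kN.
apply: (@half_open_below_num _ _ htheta _ _ _ (psum f M)); last exact: bh.
rewrite -gM psum_homo ?(leq_trans kN) //=.
apply: (@lt_le_trans _ _ (psum_succ g M)).
  by rewrite psum_succE ltrDl invr_gt0 natP_gt0.
rewrite ler_pdivrMr ?natP_gt0 // mulrAC ler_pdivlMr ?natP_gt0 //.
rewrite -!natrM ler_nat; apply: prefix_num_reduced_gap => //.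
by rewrite (leq_trans kN).
Qed.

Lemma real_of_value_base x s :
  real_of_base theta (value_base x s) = [set f | has_value f x /\ odd (f 0%N) = s].
Proof.
apply/seteqP; split=> f /=.
  move=> [h [hr v o] cf]; split; last first.
    by have [t at_ /(_ 0%N isT)] := cf 1%N isT; rewrite contract_seq0 // => ->.
  have cK K : exists2 t, applicable_seq theta t f & psum (contract_seq theta t f) K = psum h K.
    have [t at_ e] := cf K.+1 isT; exists t => //; congr (_%:R / _).
    by apply: eq_prefix_num => k /andP[_ kK]; apply: e; apply: leqW.
  apply: has_value_cofinal v => K; have [t at_ e] := cK K; last first.
    exists K; rewrite -e ler_pM2r ?invr_gt0 ?natP_gt0 // ler_nat.
    exact: prefix_num_contract_seq_ge.
  (* Beyond every index contracted in [t], so the prefix at [L] is unchanged. *)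
  pose L := maxn K (\max_(n <- t) n).+1.
  exists L; rewrite -e; apply: le_trans (psum_homo _ htheta _ (leq_maxl K _ : K <= L)%N) _.
  rewrite /psum prefix_num_contract_seq // => n nt.
  by rewrite leq_max ltnS leq_bigmax_seq // orbT.
move=> [v o]; have x0 := has_value_ge0 v.
case: (pselect (exists M, psum f M = x)) => [[M fM]|nM].
  (* The sums of [f] reach [x] at [M] and stay there, so the floors of [x * P k] are the right
     numerators. *)
  have [h [hr h0 b]] := exists_expansion_below htheta (f 0%N) x0.
  exists h.
    split=> //; last by rewrite h0.
    by apply: bounds_has_value => // k /b/andP[-> /ltW].
  move=> N N0; apply: (contract_to_expansion (leq_maxl N M)) => // k /andP[k0 _].
  suff -> : psum f (maxn N M) = x by apply: b.
  by apply/eqP; rewrite eq_le v.1 -fM psum_homo // leq_maxr.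
have fx M : psum f M < x.
  by rewrite lt_neqAle v.1 andbT; apply/eqP => fM; apply: nM; exists M.
(* The sums of [f] stay strictly below [x]. The expansion from strictly below has [psum h N < x], so
   some sum of [f] passes [psum h N] while remaining under all upper ends. *)
have [h [hr h0 b]] := exists_expansion_above htheta (f 0%N)
  (le_lt_trans (psum_ge0 _ _ _ _) (fx 0%N)).
exists h.
  split=> //; last by rewrite h0.
  by apply: bounds_has_value => // k /b/andP[/ltW -> ->].
move=> N N0; have [K NK] : exists K, psum h N < psum f K.
  by apply: v.2; case/andP: (b N N0).
apply: (contract_to_expansion (leq_maxl N K)) => // k /andP[k0 kN].
have /andP[_ hk] := b k k0; rewrite (lt_le_trans (fx _) hk) andbT.
apply: le_trans (psum_homo _ htheta _ kN) _; apply: le_trans (ltW NK) _.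
by apply: psum_homo => //; apply: leq_maxr.
Qed.

(** * Real numbers and their product *)

Lemma value_class0 s t : value_class 0 s = value_class 0 t.
Proof. by apply/seteqP; split=> f [v _]; split=> //; left. Qed.

Lemma real_numbersP X :
  real_numbers theta X <-> exists x s, 0 <= x /\ X = value_class x s.
Proof.
have real0 s : real_of_base theta (base1 theta) `|` real_of_base theta (base2 theta) =
    value_class 0 s.
  rewrite base1E base2E !real_of_value_base; apply/seteqP; split=> f /=.
    by case=> -[v _]; split=> //; left.
  by move=> [v _]; case: (boolP (odd (f 0%N))); [right | left].
have realx x s : x != 0 -> real_of_base theta (value_base x s) = value_class x s.
  move=> /eqP x0; rewrite real_of_value_base; apply/seteqP; split=> f /=.
    by move=> [v o]; split=> //; right.
  by move=> [v [//|o]].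
split=> [[[b [/base_value_base[x [s [x0 ->]]] nb] <-]|->]|[x [s [x0 ->]]]].
- exists x, s; split=> //; apply: realx; apply/eqP => xe; apply: nb.
  by rewrite base1E base2E xe; case: (s); [right | left].
- by exists 0, true; rewrite (real0 true).
case: (eqVneq x 0) => [->|xn0]; first by right; rewrite -real0.
left; exists (value_base x s); last exact: realx.
split; first exact: base_value_baseT.
have [h hb] := value_base_nonempty s x0.
have ne t : value_base x s <> value_base 0 t.
  move=> e; move: (hb); rewrite e => -[_ v0 _]; case: hb => _ v _.
  by move: xn0; rewrite (has_value_uniq v v0) eqxx.
by rewrite base1E base2E => -[/ne|/ne].
Qed.

(** The class is unique: [f] determines its value, and its parity fixes [s] except at 0, where the
    class does not depend on [s]. *)
Lemma real_of_value_class f x : has_value f x ->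
  real_of theta f = value_class x (odd (f 0%N)).
Proof.
move=> v; apply: xget_unique.
  split; last by split=> //; right.
  by apply/real_numbersP; exists x, (odd (f 0%N)); split=> //; exact: has_value_ge0 v.
move=> X [/real_numbersP[y [s [_ ->]]] [vy]].
rewrite -(has_value_uniq v vy) => -[->|<-//]; exact: value_class0.
Qed.

Lemma real_mul_value_class x y s t : 0 <= x -> 0 <= y ->
  real_mul theta (value_class x s) (value_class y t) = value_class (x * y) (s (+) t).
Proof.
move=> x0 y0.
have mul f g : value_class x s f -> value_class y t g ->
    real_of theta (subprod theta f g) = value_class (x * y) (s (+) t).
  move=> [vf of_] [vg og]; rewrite (real_of_value_class (has_value_subprod htheta vf vg)).
  rewrite /subprod eqxx oddD.
  case: of_ => [->|->]; first by rewrite mul0r; exact: value_class0.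
  by case: og => [->|-> //]; rewrite mulr0; exact: value_class0.
have [f [_ vf of_]] := value_base_nonempty s x0.
have [g [_ vg og]] := value_base_nonempty t y0.
apply/seteqP; split=> [h [f' ff' [g' gg']]|h]; first by rewrite mul.
(* Both classes are inhabited, so the union of equal sets is not empty by default. *)
have cf : value_class x s f by split=> //; right.
have cg : value_class y t g by split=> //; right.
by rewrite -(mul _ _ cf cg) => hh; exists f => //; exists g.
Qed.

End Classes.

Theorem mainTheorem12 (theta : nat -> nat) (htheta : system_function theta)
    (F G W : set (nat -> nat))
    (hF : real_numbers theta F) (hG : real_numbers theta G)
    (hW : real_numbers theta W) :
  real_mul theta (real_mul theta F G) W = real_mul theta F (real_mul theta G W).
Proof.
(* The statement mentions no field of reals; one is fixed here to measure values. *)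
pose R : realType := Rdefinitions.R.
have [x [s [x0 ->]]] := (real_numbersP R htheta F).1 hF.
have [y [t [y0 ->]]] := (real_numbersP R htheta G).1 hG.
have [z [u [z0 ->]]] := (real_numbersP R htheta W).1 hW.
by rewrite !real_mul_value_class ?mulr_ge0 // mulrA addbA.
Qed.
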